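(* Let $\eta>0$ and let $v,v'\in S^{d-1}$ with $v\ne v'$ and $\langle v,v'\rangle>0$. Let $u^{(1)}\in S^{d-1}$ be a starting opinion such that $\langle u^{(1)},v\rangle\ne 0$ or $\langle u^{(1)},v'\rangle\ne 0$. Let $u^{(t+1)}=f(u^{(t)},v^{(t)})$ for $t\ge 1$, where the interventions $v^{(1)},v^{(2)},\ldots$ are independent, each equal to $v$ or $v'$ with probability $1/2$. Then, almost surely, as $t\to\infty$, either the Euclidean distance between $u^{(t)}$ and the convex cone generated by $v$ and $v'$ goes to $0$, or the Euclidean distance between $u^{(t)}$ and the convex cone generated by $-v$ and $-v'$ goes to $0$.
   Context: $S^{d-1}$ is the Euclidean unit sphere in $\mathbb{R}^d$, $\langle\cdot,\cdot\rangle$ the standard inner product. For a fixed parameter $\eta>0$, applying an intervention $\bar v\in S^{d-1}$ to an opinion $u\in S^{d-1}$ gives $f(u,\bar v)=w/\|w\|$, where $w=u+\eta\langle u,\bar v\rangle\bar v$ (here $\|w\|\ge1$). The convex cone generated by two vectors $a,b$ is $\{\alpha a+\beta b:\alpha,\beta\ge 0\}$. *)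

(* Defs.v *)
From HB Require Import structures.
From mathcomp Require Import all_boot all_order all_algebra finmap.
From mathcomp Require Import all_classical all_reals all_analysis.
Set Implicit Arguments.
Unset Strict Implicit.
Unset Printing Implicit Defensive.
Import Order.TTheory GRing.Theory Num.Theory.
Import numFieldNormedType.Exports.
Local Open Scope classical_set_scope.
Local Open Scope ring_scope.

Definition dotv (R : realType) (d : nat) (a b : 'rV[R]_d) : R :=
  \sum_(i < d) a ord0 i * b ord0 i.

(* The library norm [`| a |] on row vectors is the max norm. *)
Definition enorm (R : realType) (d : nat) (a : 'rV[R]_d) : R :=
  Num.sqrt (dotv a a).

Definition unit_sphere (R : realType) (d : nat) : set 'rV[R]_d :=
  [set a | enorm a = 1].

Definition edist_set (R : realType) (d : nat) (a : 'rV[R]_d)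
    (A : set 'rV[R]_d) : R :=
  inf [set enorm (a - c) | c in A].

Definition cone2 (R : realType) (d : nat) (a b : 'rV[R]_d) : set 'rV[R]_d :=
  [set c | exists x y : R, [/\ 0 <= x, 0 <= y & c = x *: a + y *: b]].

Definition intervene (R : realType) (d : nat) (eta : R) (u v : 'rV[R]_d) :
    'rV[R]_d :=
  let w := u + (eta * dotv u v) *: v in (enorm w)^-1 *: w.

(* Times are counted from 0: [opinion eta u1 vs t] is u^(t+1) and [vs t] is
   v^(t+1). *)
Fixpoint opinion (R : realType) (d : nat) (eta : R) (u1 : 'rV[R]_d)
    (vs : nat -> 'rV[R]_d) (t : nat) : 'rV[R]_d :=
  if t is s.+1 then intervene eta (opinion eta u1 vs s) (vs s) else u1.

(* R^d with its Borel sigma-algebra.  The max norm and the Euclidean norm have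
   the same open sets. *)
Definition borel_rV (R : realType) (d : nat) :=
  g_sigma_algebraType (@open 'rV[R]_d).

Definition mutually_independent (dT dT' : measure_display)
    (T : measurableType dT) (T' : measurableType dT') (R : realType)
    (P : probability T R) (X : nat -> {RV P >-> T'}) : Prop :=
  forall (J : {fset nat}) (B : nat -> set T'),
    (forall i, i \in J -> measurable (B i)) ->
    P (\bigcap_(i in [set` J]) (X i @^-1` B i)) =
    (\prod_(i <- J) P (X i @^-1` B i))%E.

(* Main.v *)
Require Import Defs.
From HB Require Import structures.
From mathcomp Require Import all_boot all_order all_algebra finmap.
From mathcomp Require Import all_classical all_reals all_analysis.
From mathcomp Require Import ring lra.
Import Order.TTheory GRing.Theory Num.Theory.
Import numFieldNormedType.Exports.
Local Open Scope classical_set_scope.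
Local Open Scope ring_scope.

(** Drop the normalisation: W(t+1) = W(t) + eta <W(t),v(t)> v(t) satisfies
    W(t) = u1 + x(t) v + y(t) v' and u(t) = W(t)/|W(t)|.  If <W,v> and <W,v'>
    are both nonnegative at some time and not both zero, they stay so, and since
    both interventions occur infinitely often, x, y and |W| tend to infinity;
    u(t) is then within |u1|/|W(t)| of the cone.  Both nonpositive reduces to
    this case by replacing (v, v') by (-v, -v'), which changes no intervention.
    Opposite signs do not persist: k applications in a row of whichever of v, v'
    has the larger |<W,.>| make the signs agree as soon as
    <v,v'> ((1+eta)^k - 1) >= 1.  In each block of k steps, whatever the past,
    this run occurs with probability 2^-k, so almost surely it occurs. *)

(** * Euclidean inner product and norm *)

Lemma dotvC {R : realType} {d : nat} (a b : 'rV[R]_d) : dotv a b = dotv b a.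
Proof. by apply: eq_bigr => i _; rewrite mulrC. Qed.

Lemma dotvDl {R : realType} {d : nat} (a b e : 'rV[R]_d) :
  dotv (a + b) e = dotv a e + dotv b e.
Proof.
by rewrite /dotv -big_split; apply: eq_bigr => i _; rewrite mxE mulrDl.
Qed.

Lemma dotvZl {R : realType} {d : nat} (x : R) (a b : 'rV[R]_d) :
  dotv (x *: a) b = x * dotv a b.
Proof.
by rewrite /dotv mulr_sumr; apply: eq_bigr => i _; rewrite mxE mulrA.
Qed.

Lemma dotvNl {R : realType} {d : nat} (a b : 'rV[R]_d) :
  dotv (- a) b = - dotv a b.
Proof. by rewrite -scaleN1r dotvZl mulN1r. Qed.

Lemma dotvDr {R : realType} {d : nat} (a b e : 'rV[R]_d) :
  dotv e (a + b) = dotv e a + dotv e b.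
Proof. by rewrite dotvC dotvDl !(dotvC _ e). Qed.

Lemma dotvZr {R : realType} {d : nat} (x : R) (a b : 'rV[R]_d) :
  dotv b (x *: a) = x * dotv b a.
Proof. by rewrite dotvC dotvZl dotvC. Qed.

Lemma dotvNr {R : realType} {d : nat} (a b : 'rV[R]_d) :
  dotv b (- a) = - dotv b a.
Proof. by rewrite dotvC dotvNl dotvC. Qed.

Definition dotvE := (@dotvDl, @dotvDr, @dotvZl, @dotvZr, @dotvNl, @dotvNr).

Lemma dotv_ge0 {R : realType} {d : nat} (a : 'rV[R]_d) : 0 <= dotv a a.
Proof. by apply: sumr_ge0 => i _; rewrite -expr2 sqr_ge0. Qed.

Lemma enorm_sqr {R : realType} {d : nat} (a : 'rV[R]_d) :
  enorm a ^+ 2 = dotv a a.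
Proof. by rewrite sqr_sqrtr ?dotv_ge0. Qed.

Lemma enormZ {R : realType} {d : nat} (x : R) (a : 'rV[R]_d) :
  enorm (x *: a) = `|x| * enorm a.
Proof.
by rewrite /enorm dotvZl dotvZr mulrA -expr2 sqrtrM ?sqr_ge0// sqrtr_sqr.
Qed.

Lemma unit_sphere_dotv {R : realType} {d : nat} (a : 'rV[R]_d) :
  unit_sphere a -> dotv a a = 1.
Proof. by move=> a1; rewrite -enorm_sqr (a1 : enorm a = 1) expr1n. Qed.

(** Half of Cauchy-Schwarz, from the nonnegative squared norm of [a] minus its projection on [b]. *)
Lemma dotv_le_enorm {R : realType} {d : nat} (a b : 'rV[R]_d) :
  unit_sphere b -> dotv a b <= enorm a.
Proof.
move=> /unit_sphere_dotv b1.
have := dotv_ge0 (a - dotv a b *: b).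
rewrite !dotvE b1 (dotvC b a) => h.
have [//|ab] := leP (dotv a b) (enorm a).
have := sqrtr_ge0 (dotv a a); rewrite -/(enorm a) => e0.
have := enorm_sqr a; nra.
Qed.

(** * The dynamics without normalisation *)

Fixpoint lin_opinion {R : realType} {d : nat} (eta : R) (u1 : 'rV[R]_d)
    (vs : nat -> 'rV[R]_d) (t : nat) : 'rV[R]_d :=
  if t is s.+1 then
    let w := lin_opinion eta u1 vs s in w + (eta * dotv w (vs s)) *: vs s
  else u1.

Lemma lin_opinionS {R : realType} {d : nat} (eta : R) (u1 : 'rV[R]_d)
    (vs : nat -> 'rV[R]_d) (t : nat) :
  let w := lin_opinion eta u1 vs t in
  lin_opinion eta u1 vs t.+1 = w + (eta * dotv w (vs t)) *: vs t.
Proof. by []. Qed.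

(** A step adds [2 eta q^2 + eta^2 q^2 p >= 0] to the squared norm, where [q = <w,v>] and
    [p = <v,v>] for the applied [v]. *)
Lemma lin_opinion_enorm_ge1 {R : realType} {d : nat} (eta : R)
    (u1 : 'rV[R]_d) (vs : nat -> 'rV[R]_d) (t : nat) :
  0 < eta -> unit_sphere u1 -> 1 <= enorm (lin_opinion eta u1 vs t).
Proof.
move=> eta0 u1S; elim: t => [|t IH] /=; first by rewrite (u1S : enorm u1 = 1).
set w := lin_opinion _ _ _ _ in IH *; apply: le_trans IH _.
rewrite ler_sqrt ?dotv_ge0// !dotvE (dotvC (vs t) w).
have := dotv_ge0 (vs t).
move: (dotv (vs t) _) (dotv w (vs t)) (dotv w w) => p q r p0.
have : 0 <= eta * q ^+ 2 by rewrite mulr_ge0 ?sqr_ge0// ltW.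
have : 0 <= (eta * q) ^+ 2 * p by rewrite mulr_ge0 ?sqr_ge0.
by nra.
Qed.

(** The unnormalised step is linear in the opinion, so positive scalars pass through it and
    normalising once at the end suffices. *)
Lemma opinionE {R : realType} {d : nat} (eta : R)
    (u1 : 'rV[R]_d) (vs : nat -> 'rV[R]_d) (t : nat) :
  0 < eta -> unit_sphere u1 ->
  let w := lin_opinion eta u1 vs t in
  opinion eta u1 vs t = (enorm w)^-1 *: w.
Proof.
move=> eta0 u1S /=; elim: t => [|t IH] /=.
  by rewrite (u1S : enorm u1 = 1) invr1 scale1r.
have := lin_opinion_enorm_ge1 _ _ vs t eta0 u1S.
rewrite /intervene IH; set w := lin_opinion _ _ _ _ => w1.
have w0 : 0 < enorm w by apply: lt_le_trans w1.
have -> : (enorm w)^-1 *: w + (eta * dotv ((enorm w)^-1 *: w) (vs t)) *: vs t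
    = (enorm w)^-1 *: (w + (eta * dotv w (vs t)) *: vs t).
  by rewrite dotvZl mulrCA scalerDr scalerA.
rewrite enormZ gtr0_norm ?invr_gt0// invfM invrK.
by rewrite scalerA mulrAC mulfV ?mul1r ?gt_eqF//.
Qed.


(** Meant for the coefficients of [v] and [v']: from some time on each never decreases, and it gains
    at least a fixed amount whenever its vector is applied. *)
Lemma increments_cvg_pinfty {R : realType} (f : nat -> R) (e : R) (t0 : nat) :
  0 < e -> (forall t, (t0 <= t)%N -> f t <= f t.+1) ->
  (forall t, exists2 s, (t <= s)%N & f s + e <= f s.+1) ->
  f t @[t --> \oo] --> +oo%R.
Proof.
move=> e0 f_nd f_inc.
have nd s t : (t0 <= s <= t)%N -> f s <= f t.
  move=> /andP[t0s]; elim: t => [|t IH]; first by rewrite leqn0 => /eqP ->.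
  rewrite leq_eqVlt => /predU1P[->//|]; rewrite ltnS => st.
  exact: le_trans (IH st) (f_nd _ (leq_trans t0s st)).
have far (n : nat) : exists2 s, (t0 <= s)%N & f t0 + n%:R * e <= f s.
  elim: n => [|n [s t0s fs]]; first by exists t0; rewrite ?mul0r ?addr0.
  have [r sr fr] := f_inc s; exists r.+1.
    by apply: leqW; apply: leq_trans sr.
  have : f s <= f r by apply: nd; rewrite t0s.
  by rewrite -natr1; lra.
apply/cvgryPge => M.
have [s t0s fs] := far (Num.truncn ((M - f t0) / e)).+1.
exists s => // t /= st; apply: le_trans (nd s t _); last by rewrite t0s.
apply: le_trans fs; rewrite addrC -lerBlDr -ler_pdivrMr//.
by rewrite ltW// truncnS_gt.
Qed.

Lemma lin_opinion_eq {R : realType} {d : nat} (eta : R) (u1 : 'rV[R]_d)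
    (vs vs' : nat -> 'rV[R]_d) (t : nat) :
  (forall s, (s < t)%N -> vs s = vs' s) ->
  lin_opinion eta u1 vs t = lin_opinion eta u1 vs' t.
Proof.
elim: t => [//|t IH] e /=; rewrite e// IH// => s st; apply: e; exact: leqW.
Qed.

Lemma lin_opinionE {R : realType} {d : nat} (eta : R) (u1 : 'rV[R]_d)
    (v v' : 'rV[R]_d) (b : nat -> bool) (t : nat) :
  let w := lin_opinion eta u1 (fun s => if b s then v else v') in
  w t = u1 + (\sum_(s < t) if b s then eta * dotv (w s) v else 0) *: v
           + (\sum_(s < t) if b s then 0 else eta * dotv (w s) v') *: v'.
Proof.
move=> w; elim: t => [|t IH]; first by rewrite !big_ord0 !scale0r !addr0.
rewrite /w lin_opinionS -/w !big_ord_recr /=.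
case: (b t); rewrite addr0 scalerDl.
  by move: (eta * dotv (w t) _) => e; rewrite IH [LHS]addrAC !addrA.
by move: (eta * dotv (w t) _) => e; rewrite IH !addrA.
Qed.

(** * Sign dynamics of the two inner products *)

(* The recurrence of A = <W,v> and B = <W,v'>, with c = <v,v'>. *)
Definition coupled_growth {R : realType} (eta c : R) (b : nat -> bool)
    (A B : nat -> R) : Prop :=
  forall t, A t.+1 = A t + eta * (if b t then A t else c * B t) /\
            B t.+1 = B t + eta * (if b t then c * A t else B t).

Lemma coupled_growthC {R : realType} (eta c : R) (b : nat -> bool)
    (A B : nat -> R) :
  coupled_growth eta c b A B -> coupled_growth eta c (negb \o b) B A.
Proof. by move=> AB t; have [-> ->] := AB t => /=; case: (b t). Qed.

Lemma lin_opinion_coupled_growth {R : realType} {d : nat} (eta : R)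
    (v v' u1 : 'rV[R]_d) (b : nat -> bool) :
  unit_sphere v -> unit_sphere v' ->
  let w := lin_opinion eta u1 (fun s => if b s then v else v') in
  coupled_growth eta (dotv v v') b
    (fun t => dotv (w t) v) (fun t => dotv (w t) v').
Proof.
move=> /unit_sphere_dotv v1 /unit_sphere_dotv v'1 w t.
rewrite /w !lin_opinionS -/w.
case: (b t); rewrite !dotvE ?v1 ?v'1 ?(dotvC v' v); split; ring.
Qed.

(** With [M = (1+eta)^k], the run multiplies [A] by [M] and adds [c (M-1) A] to [B]. The product
    becomes [M (A B + c (M-1) A^2)], and [|A B| <= A^2 <= c (M-1) A^2]. *)
Lemma run_same_sign {R : realType} (eta c : R) (b : nat -> bool)
    (A B : nat -> R) (t k : nat) :
  0 < eta -> coupled_growth eta c b A B -> 1 <= c * ((1 + eta) ^+ k - 1) ->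
  (forall j, (j < k)%N -> b (t + j)%N) -> `|B t| <= `|A t| ->
  0 <= A (t + k)%N * B (t + k)%N.
Proof.
move=> eta0 AB ck run BA.
have H j : (j <= k)%N -> A (t + j)%N = (1 + eta) ^+ j * A t /\
    B (t + j)%N = B t + c * ((1 + eta) ^+ j - 1) * A t.
  elim: j => [|j IH] jk; first by rewrite addn0 expr0; split; ring.
  have [IHA IHB] := IH (ltnW jk).
  have := AB (t + j)%N; rewrite run// -addnS IHA IHB exprS => -[-> ->].
  by split; ring.
have [-> ->] := H k (leqnn k).
have M0 : 0 <= (1 + eta) ^+ k by rewrite exprn_ge0// addr_ge0// ltW.
rewrite -mulrA mulr_ge0// mulrDr.
have : - (A t * B t) <= `|A t| * `|A t|.
  apply: le_trans (ler_wpM2l (normr_ge0 _) BA).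
  by rewrite -normrM -normrN ler_norm.
rewrite -normrM ger0_norm; last by rewrite -expr2 sqr_ge0.
have := sqr_ge0 (A t); nra.
Qed.

(** Nonnegative sequences can only grow. A step along the vector with positive inner product makes
    the other one positive too, as [c > 0], and both then stay above their values at that time. *)
Lemma coupled_growth_lbound {R : realType} (eta c : R) (b : nat -> bool)
    (A B : nat -> R) (t0 : nat) :
  0 < eta -> 0 < c -> coupled_growth eta c b A B ->
  (forall t, exists2 s, (t <= s)%N & b s) ->
  (forall t, exists2 s, (t <= s)%N & ~~ b s) ->
  0 <= A t0 -> 0 <= B t0 -> A t0 <> 0 \/ B t0 <> 0 ->
  exists e : R, exists t1 : nat,
    0 < e /\ forall t, (t1 <= t)%N -> e <= A t /\ e <= B t.
Proof.
move=> eta0 c0.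
(* Exchanging [A] and [B] negates [b], which exchanges the two infinitely-often hypotheses. *)
wlog At0 : A B b / A t0 <> 0.
  move=> wl AB bT bF A0 B0 [An0|Bn0]; first by apply: (wl A B b) => //; left.
  have bT' t : exists2 s, (t <= s)%N & ~~ (negb \o b) s.
    by have [s ts bs] := bT t; exists s; rewrite //= negbK.
  have [e [t1 [e0 H]]] := wl B A (negb \o b) Bn0 (coupled_growthC _ _ _ _ _ AB)
    bF bT' B0 A0 (or_introl Bn0).
  by exists e, t1; split=> // t tt; have [] := H t tt.
move=> AB bT _ A0 B0 _.
have ge0 t : (t0 <= t)%N ->
    [/\ 0 <= A t, 0 <= B t, A t <= A t.+1 & B t <= B t.+1].
  move=> /subnK <-; elim: (t - t0)%N => [|j [IHA IHB IHA' IHB']]; last first.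
    have := AB (j.+1 + t0)%N; rewrite addSn => -[-> ->].
    have A1 := le_trans IHA IHA'; have B1 := le_trans IHB IHB'.
    by rewrite A1 B1 !lerDl; split=> //;
      case: ifP => _; rewrite !mulr_ge0// ltW.
  have [-> ->] := AB t0.
  by rewrite A0 B0 !lerDl; split=> //; case: ifP => _; rewrite !mulr_ge0// ltW.
have nd s t : (t0 <= s)%N -> (s <= t)%N -> A s <= A t /\ B s <= B t.
  move=> ts /subnK <-; elim: (t - s)%N => [//|j [IHA IHB]].
  have [_ _ ? ?] := ge0 (j + s)%N (leq_trans ts (leq_addl _ _)).
  by rewrite addSn; split; [apply: le_trans IHA _ | apply: le_trans IHB _].
have [s ts bs] := bT t0.
have As : 0 < A s.
  by apply: lt_le_trans (nd t0 s _ _).1 => //;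
    rewrite lt_def A0 andbT; apply/eqP.
have [_ Bs _ _] := ge0 s ts.
have := AB s; rewrite bs => -[As1 Bs1].
have As1p : 0 < A s.+1 by rewrite As1 addr_gt0// mulr_gt0.
have Bs1p : 0 < B s.+1 by rewrite Bs1 ltr_wpDl// !mulr_gt0.
exists (Num.min (A s.+1) (B s.+1)), s.+1; split; first by rewrite lt_min As1p.
by move=> t st; have [? ?] := nd s.+1 t (leqW ts) st; split;
  rewrite ge_min; apply/orP; [left|right].
Qed.

(* The last bit of a run of length [t.+1] has index at least [t]. *)
Lemma infinitely_often_of_runs (p : nat -> bool) :
  (forall k, exists n, forall j, (j < k)%N -> p (n * k + j)%N) ->
  forall t, exists2 s, (t <= s)%N & p s.
Proof.
move=> runs t; have [n H] := runs t.+1.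
by exists (n * t.+1 + t)%N; [exact: leq_addl | exact: H].
Qed.

(** * Convergence to the cone *)

Lemma edist_set_cone2_cvg0 {R : realType} {d : nat} (eta : R)
    (v v' u1 : 'rV[R]_d) (b : nat -> bool) (t0 : nat) :
  0 < eta -> 0 < dotv v v' ->
  unit_sphere v -> unit_sphere v' -> unit_sphere u1 ->
  (forall t, exists2 s, (t <= s)%N & b s) ->
  (forall t, exists2 s, (t <= s)%N & ~~ b s) ->
  let vs := fun s => if b s then v else v' in
  let w := lin_opinion eta u1 vs in
  0 <= dotv (w t0) v -> 0 <= dotv (w t0) v' ->
  dotv (w t0) v <> 0 \/ dotv (w t0) v' <> 0 ->
  edist_set (opinion eta u1 vs t) (cone2 v v') @[t --> \oo] --> (0 : R).
Proof.
move=> eta0 c0 vS v'S u1S bT bF vs w A0 B0 n0.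
have AB := lin_opinion_coupled_growth eta v v' u1 b vS v'S.
have [e [t1 [e0 He]]] :=
  coupled_growth_lbound _ _ _ _ _ _ eta0 c0 AB bT bF A0 B0 n0.
pose x t := \sum_(s < t) if b s then eta * dotv (w s) v else 0.
pose y t := \sum_(s < t) if b s then 0 else eta * dotv (w s) v'.
have x_oo : x t @[t --> \oo] --> +oo%R.
  apply: (increments_cvg_pinfty _ (eta * e) t1); first exact: mulr_gt0.
    move=> t /He[At _]; rewrite /x big_ord_recr /= lerDl; case: ifP => // _.
    by rewrite mulr_ge0 ?(ltW eta0)// (le_trans (ltW e0)).
  move=> t; have [s] := bT (maxn t t1); rewrite geq_max => /andP[ts t1s] bs.
  exists s => //; rewrite /x big_ord_recr /= bs lerD2l ler_pM2l//.
  by have [] := He s t1s.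
have y_oo : y t @[t --> \oo] --> +oo%R.
  apply: (increments_cvg_pinfty _ (eta * e) t1); first exact: mulr_gt0.
    move=> t /He[_ Bt]; rewrite /y big_ord_recr /= lerDl; case: ifP => // _.
    by rewrite mulr_ge0 ?(ltW eta0)// (le_trans (ltW e0)).
  move=> t; have [s] := bF (maxn t t1); rewrite geq_max => /andP[ts t1s] bs.
  exists s => //; rewrite /y big_ord_recr /= (negbTE bs) lerD2l ler_pM2l//.
  by have [] := He s t1s.
move/cvgryPge: x_oo => x_ge; move/cvgryPge: y_oo => y_ge.
have wE t : w t = u1 + x t *: v + y t *: v' by exact: lin_opinionE.
have w_ge1 t : 1 <= enorm (w t) by exact: lin_opinion_enorm_ge1.
have w_oo : enorm (w t) @[t --> \oo] --> +oo%R.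
  apply/cvgryPge => M; near=> t.
  have xM : M - dotv u1 v <= x t by near: t; exact: x_ge.
  have y0 : 0 <= y t by near: t; exact: y_ge.
  (* [|w| >= <w,v> = <u1,v> + x + y <v,v'>], where the last term is nonnegative. *)
  apply: le_trans (dotv_le_enorm _ _ vS).
  rewrite wE !dotvE (unit_sphere_dotv _ vS) (dotvC v' v) mulr1.
  have := mulr_ge0 y0 (ltW c0); lra.
have w_inv : (enorm (w t))^-1 @[t --> \oo] --> (0 : R).
  apply/gtr0_cvgV0 => //; near=> t; exact: lt_le_trans (w_ge1 t).
apply: (squeeze_cvgr _ (cvg_cst (0 : R)) w_inv).
near=> t.
have x0 : 0 <= x t by near: t; exact: x_ge.
have y0 : 0 <= y t by near: t; exact: y_ge.
have lb : lbound [set enorm (opinion eta u1 vs t - z) | z in cone2 v v'] 0.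
  by move=> _ [z _ <-]; exact: sqrtr_ge0.
have wt0 : 0 < (enorm (w t))^-1 by rewrite invr_gt0 (lt_le_trans ltr01).
apply/andP; split.
  apply: lb_le_inf => //; exists (enorm (opinion eta u1 vs t - 0)).
  exists 0 => //.
  by exists 0, 0; rewrite !scale0r addr0.
apply: ge_inf; first by exists 0.
(* Dropping [u1] from [w] leaves a point of the cone; after scaling, its distance to the opinion is
   exactly [1/|w|]. *)
exists ((enorm (w t))^-1 *: (x t *: v + y t *: v')).
  exists ((enorm (w t))^-1 * x t), ((enorm (w t))^-1 * y t).
  by split; rewrite ?mulr_ge0 ?(ltW wt0)// scalerDr !scalerA.
rewrite opinionE// -/(w t) -scalerBr [X in X - _]wE -(addrA u1) addrK enormZ.
by rewrite (u1S : enorm u1 = 1) mulr1 gtr0_norm.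
Unshelve. all: by end_near.
Qed.

(** * Sign reversal and the pathwise dichotomy *)

(** [v] enters the update twice, so its sign cancels. *)
Lemma intervene_oppr {R : realType} {d : nat} (eta : R) (u v : 'rV[R]_d) :
  intervene eta u (- v) = intervene eta u v.
Proof. by rewrite /intervene dotvNr mulrN scaleNr scalerN opprK. Qed.

Lemma opinion_oppr {R : realType} {d : nat} (eta : R) (u1 : 'rV[R]_d)
    (vs : nat -> 'rV[R]_d) (t : nat) :
  opinion eta u1 (fun s => - vs s) t = opinion eta u1 vs t.
Proof. by elim: t => //= t ->; rewrite intervene_oppr. Qed.

Lemma lin_opinion_oppr {R : realType} {d : nat} (eta : R) (u1 : 'rV[R]_d)
    (vs : nat -> 'rV[R]_d) (t : nat) :
  lin_opinion eta u1 (fun s => - vs s) t = lin_opinion eta u1 vs t.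
Proof. by elim: t => //= t ->; rewrite dotvNr mulrN scaleNr scalerN opprK. Qed.

Lemma unit_sphereN {R : realType} {d : nat} (a : 'rV[R]_d) :
  unit_sphere a -> unit_sphere (- a).
Proof. by rewrite /unit_sphere /= -scaleN1r enormZ normrN1 mul1r. Qed.

(** Each step is injective: the inner product with the applied vector is multiplied by [1 + eta],
    and the other one can then be recovered. *)
Lemma coupled_growth_neq0 {R : realType} (eta c : R) (b : nat -> bool)
    (A B : nat -> R) (t : nat) :
  0 < eta -> coupled_growth eta c b A B -> A 0%N <> 0 \/ B 0%N <> 0 ->
  A t <> 0 \/ B t <> 0.
Proof.
move=> eta0 AB n0; elim: t => [//|t IH].
suff : ~ (A t.+1 = 0 /\ B t.+1 = 0).
  by move=> /not_andP.
have e1 : 1 + eta != 0 by rewrite gt_eqF// addr_gt0.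
have inj x : x + eta * x = 0 -> x = 0.
  rewrite -[X in X + _]mul1r -mulrDl => /eqP.
  by rewrite mulf_eq0 (negbTE e1) => /eqP.
have [-> ->] := AB t; case: (b t) => -[].
  by move=> /inj A0; rewrite A0 !mulr0 addr0 => B0; case: IH.
by move=> + /inj B0; rewrite B0 !mulr0 addr0 => A0; case: IH.
Qed.

(** Taking a finite word makes this choice a function of the past, as the block argument requires.
    The default [false] is never read: only indices below [size s] occur. *)
Definition dominant {R : realType} {d : nat} (eta : R) (v v' u1 : 'rV[R]_d)
    (s : seq bool) : bool :=
  let w :=
    lin_opinion eta u1 (fun i => if nth false s i then v else v') (size s) in
  `|dotv w v'| <= `|dotv w v|.

(** The deterministic half of the proof: a run of the dominant vector started at [n] makes the signs
    agree at [n + k], and convergence is argued from that time on. *)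
Lemma opinion_dichotomy {R : realType} {d : nat} (eta : R)
    (v v' u1 : 'rV[R]_d) (b : nat -> bool) (k n : nat) :
  0 < eta -> 0 < dotv v v' ->
  unit_sphere v -> unit_sphere v' -> unit_sphere u1 ->
  dotv u1 v <> 0 \/ dotv u1 v' <> 0 ->
  (forall t, exists2 s, (t <= s)%N & b s) ->
  (forall t, exists2 s, (t <= s)%N & ~~ b s) ->
  1 <= dotv v v' * ((1 + eta) ^+ k - 1) ->
  (forall j, (j < k)%N -> b (n + j)%N = dominant eta v v' u1 (mkseq b n)) ->
  let u := opinion eta u1 (fun s => if b s then v else v') in
  edist_set (u t) (cone2 v v') @[t --> \oo] --> (0 : R) \/
  edist_set (u t) (cone2 (- v) (- v')) @[t --> \oo] --> (0 : R).
Proof.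
move=> eta0 c0 vS v'S u1S n0 bT bF ck run u.
pose w := lin_opinion eta u1 (fun s => if b s then v else v').
have AB := lin_opinion_coupled_growth eta v v' u1 b vS v'S.
have nk := coupled_growth_neq0 _ _ _ _ _ (n + k) eta0 AB n0.
have domE : dominant eta v v' u1 (mkseq b n) =
    (`|dotv (w n) v'| <= `|dotv (w n) v|).
  rewrite /dominant size_mkseq.
  rewrite (lin_opinion_eq eta u1 _ (fun s => if b s then v else v'))//.
  by move=> s sn; rewrite nth_mkseq.
have : 0 <= dotv (w (n + k)%N) v * dotv (w (n + k)%N) v'.
  move: run; rewrite domE; case: leP => [le run|/ltW le run].
    by apply: (run_same_sign _ _ _ _ _ _ _ eta0 AB ck).
  rewrite mulrC.
  have BA := coupled_growthC _ _ _ _ _ AB.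
  apply: (run_same_sign _ _ _ _ _ _ _ eta0 BA ck) => //.
  by move=> j jk /=; rewrite run.
move=> AB0.
have [[A0 B0]|[A0 B0]] :
    0 <= dotv (w (n + k)%N) v /\ 0 <= dotv (w (n + k)%N) v' \/
    dotv (w (n + k)%N) v <= 0 /\ dotv (w (n + k)%N) v' <= 0.
  move: AB0; case: (leP 0 (dotv _ v)) => A0; case: (leP 0 (dotv _ v')) => B0.
  - by left.
  - by rewrite nmulr_lge0// => ?; right; split=> //; exact: ltW.
  - by rewrite nmulr_rge0// => ?; right; split=> //; exact: ltW.
  - by right; split; exact: ltW.
- by left; exact: (edist_set_cone2_cvg0 _ _ _ _ _ (n + k)).
right.
have vsN : (fun s => if b s then - v else - v') =
    (fun s => - (if b s then v else v')).
  by apply/funext => s; case: ifP.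
have /= := edist_set_cone2_cvg0 eta (- v) (- v') u1 b (n + k) eta0.
rewrite vsN lin_opinion_oppr -/w dotvNl !dotvNr opprK !oppr_ge0.
rewrite (funext (opinion_oppr eta u1 _)).
apply=> //; [exact: unit_sphereN|exact: unit_sphereN|].
by case: nk => nz; [left|right] => /eqP; rewrite oppr_eq0 => /eqP.
Qed.

(** * Random words and constant blocks *)

Definition cylinder {T : Type} (E : nat -> bool -> set T) (s : seq bool) :
    set T :=
  \bigcap_(i in [set i | (i < size s)%N]) E i (nth false s i).

(** [g] prescribes the letter of each block from the past. The word [b] is quantified existentially
    because [E t true] and [E t false] are not assumed disjoint. *)
Definition no_constant_block {T : Type} (E : nat -> bool -> set T) (k : nat)
    (g : seq bool -> bool) (s : seq bool) (m : nat) : set T :=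
  [set w | exists b : nat -> bool, [/\ forall t, E t (b t) w,
     mkseq b (size s) = s &
     forall i, (i < m)%N -> exists2 j, (j < k)%N &
       b (size s + i * k + j)%N != g (mkseq b (size s + i * k))]].

(* A measurable cover avoids proving that the set itself is measurable.
   Excluding the constant block [g s] rules out one of the 2^k words that extend
   [s], whence the factor [1 - 2^-k] in the induction on [m]. *)
Lemma no_constant_block_cover {R : realType} {dT : measure_display}
    {T : measurableType dT} (P : probability T R) (E : nat -> bool -> set T)
    (k : nat) (g : seq bool -> bool) :
  (forall t a, measurable (E t a)) ->
  (forall s, (P (cylinder E s) <= ((2^-1) ^+ size s)%:E)%E) ->
  forall m s, exists C, [/\ measurable C, no_constant_block E k g s m `<=` C &
    (P C <= ((2^-1) ^+ size s * (1 - (2^-1) ^+ k) ^+ m)%:E)%E].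
Proof.
move=> mE PE; elim=> [|m IH] s.
  exists (cylinder E s); split.
  - by apply: bigcap_measurableType => i _; exact: mE.
  - move=> w [b [bE bs _]] i /= ilt.
    by rewrite -bs nth_mkseq.
  - by rewrite expr0 mulr1.
have [C HC] := choice IH.
(* One cover for each admissible first block [t], with [m] further blocks to come. *)
pose D := \big[setU/set0]_(t : k.-tuple bool | t != nseq k (g s) :> seq bool)
  C (s ++ t).
have mD : measurable D.
  by apply: bigsetU_measurable => t _; have [] := HC (s ++ t).
exists D; split => //.
  move=> w [b [bE bs bad]].
  have mk (j : nat) : mkseq b (j + size s) =
      s ++ mkseq (fun i => b (size s + i)%N) j.
    rewrite addnC /mkseq iotaD map_cat -/(mkseq b (size s)) bs add0n.
    by rewrite -[X in iota X]addn0 iotaDl -map_comp.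
  pose t := [tuple b (size s + i)%N | i < k].
  have tE : t = mkseq (fun i => b (size s + i)%N) k :> seq bool.
    by rewrite /= -val_ord_tuple /mkseq -val_enum_ord -map_comp.
  have tn : t != nseq k (g s) :> seq bool.
    apply/eqP => tg; have [j jk] := bad 0%N erefl.
    rewrite mul0n addn0 bs => /eqP; apply.
    by have := congr1 (nth false ^~ j) tg; rewrite tE nth_mkseq// nth_nseq jk.
  rewrite /D -bigcup_seq_cond; exists t; first by rewrite /= mem_index_enum.
  have [_ + _] := HC (s ++ t); apply; exists b; split => //.
    by rewrite size_cat size_tuple addnC mk tE.
  move=> i im; have [j jk bad'] := bad i.+1 im; exists j => //.
  by move: bad'; rewrite size_cat size_tuple mulSn !addnA.
apply: (@le_trans _ _ (\sum_(t : k.-tuple bool | t != nseq k (g s) :> seq bool)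
    ((2^-1) ^+ size (s ++ t) * (1 - (2^-1) ^+ k) ^+ m)%:E)%E).
  rewrite /D.
  (* Finite subadditivity; measurability is carried along because each union bound uses it. *)
  apply: (big_ind2 (fun A x => measurable A /\ (P A <= x)%E) _ _ _).2.
  - by rewrite measure0.
  - move=> A x B y [mA PA] [mB PB]; split; first exact: measurableU.
    exact: le_trans (measureU2 _ mA mB) (leeD PA PB).
  - by move=> t _; have [? _ ?] := HC (s ++ t).
rewrite sumEFin lee_fin.
under eq_bigr => t _ do rewrite size_cat size_tuple.
rewrite sumr_const.
rewrite (_ : #|_| = (2 ^ k).-1); last first.
  rewrite (eq_card (B := predC1 (nseq_tuple k (g s))))//.
  by rewrite cardC1 card_tuple card_bool.
(* What remains is [(2^k - 1) 2^-(|s|+k) = 2^-|s| (1 - 2^-k)]. *)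
rewrite -subn1 mulrnBr ?expn_gt0// mulr1n.
rewrite -[X in X - _]mulr_natr natrX exprD exprS.
have : (2^-1 : R) ^+ k * 2%:R ^+ k = 1 by rewrite -exprMn mulVf// expr1n.
move: (_ ^+ k) (_ ^+ k) (_ ^+ m) (_ ^+ size s) => x y z u xy.
suff -> : u * y * z * x = u * z by rewrite le_eqVlt; apply/predU1P; left; ring.
by rewrite mulrAC -(mulrA u) xy mulr1.
Qed.

(** The covers for the empty prefix intersect in a set of measure at most [(1 - 2^-k)^m] for every
    [m], hence null. Keeping [g] general serves both the dominant choice and the runs of a fixed
    letter. *)
Lemma constant_block_ae {R : realType} {dT : measure_display}
    {T : measurableType dT} (P : probability T R) (E : nat -> bool -> set T)
    (k : nat) (g : seq bool -> bool) :
  (forall t a, measurable (E t a)) ->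
  (forall s, (P (cylinder E s) <= ((2^-1) ^+ size s)%:E)%E) ->
  {ae P, forall w, forall b : nat -> bool, (forall t, E t (b t) w) ->
    exists n, forall j, (j < k)%N -> b (n * k + j)%N = g (mkseq b (n * k))}.
Proof.
move=> mE PE.
have [C HC] := choice (fun m => no_constant_block_cover P E k g mE PE m [::]).
have mC : measurable (\bigcap_m C m).
  by apply: bigcap_measurableType => m _; have [] := HC m.
exists (\bigcap_m C m); split => //.
  apply/eqP; rewrite -measure_le0; apply/lee_addgt0Pr => e e0; rewrite add0e.
  have q1 : `|1 - (2^-1) ^+ k : R| < 1.
    have h0 : 0 < (2^-1 : R) ^+ k by rewrite exprn_gt0.
    have h1 : (2^-1 : R) ^+ k <= 1 by rewrite exprn_ile1//; lra.
    by rewrite ger0_norm; lra.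
  have /cvgrPdist_lt/(_ e e0)[m _ /(_ m (leqnn m))] := cvg_expr q1.
  rewrite sub0r normrN => /= qm.
  have [mCm _ PC] := HC m.
  apply: (@le_trans _ _ (P (C m))).
    by apply: le_measure; rewrite ?inE//; exact: bigcap_inf.
  apply: le_trans PC _; rewrite expr0 mul1r lee_fin ltW//.
  exact: le_lt_trans (ler_norm _) qm.
(* A point with no good block lies in the bad set, hence in its cover, for every [m]. *)
move=> w /= /existsNP[b /not_implyP[bE nb]] m _.
have [_ + _] := HC m; apply; exists b; split => //= i im.
have /existsNP[j /not_implyP[jk /eqP bj]] := (forallNP _).2 nb i.
by exists j.
Qed.

Lemma half_cylinder {R : realType} {dT dT' : measure_display}
    {T : measurableType dT} {T' : measurableType dT'} (P : probability T R)
    (X : nat -> {RV P >-> T'}) (A : bool -> set T') :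
  (forall a, measurable (A a)) -> mutually_independent X ->
  (forall t a, P (X t @^-1` A a) = (2^-1)%:E) ->
  forall s, P (cylinder (fun t a => X t @^-1` A a) s) = ((2^-1) ^+ size s)%:E.
Proof.
move=> mA indep half s.
pose J := [fset i in iota 0 (size s)]%fset.
have := indep J (fun i => A (nth false s i)) (fun i _ => mA _).
have -> : [set` J] = [set i | (i < size s)%N].
  by apply/seteqP; split => i /=; rewrite inE /= mem_iota add0n.
rewrite /cylinder => ->.
under eq_bigr do rewrite half.
rewrite prodEFin big_const_seq count_predT iter_mulr_1.
rewrite card_fseq undup_id ?iota_uniq// size_iota //.
Qed.

(** * Borel singletons, the run length and the conclusion *)

Lemma measurable_set1_borel_rV {R : realType} {d : nat} (a : 'rV[R]_d) :
  measurable ([set a] : set (borel_rV R d)).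
Proof.
rewrite -[X in measurable X]setCK; apply: measurableC.
apply: sub_sigma_algebra; apply: closed_openC.
exact/accessible_closed_set1/hausdorff_accessible/norm_hausdorff.
Qed.

(** By Bernoulli's inequality [(1+eta)^k - 1 >= k eta], so any [k > 1/(c eta)] will do. *)
Lemma geometric_unbounded {R : realType} (eta c : R) : 0 < eta -> 0 < c ->
  exists k, 1 <= c * ((1 + eta) ^+ k - 1).
Proof.
move=> eta0 c0.
have bern k : 1 + k%:R * eta <= (1 + eta) ^+ k.
  elim: k => [|k IH]; first by rewrite mul0r addr0 expr0.
  rewrite exprS -natr1; have := mulr_ge0 (ler0n R k) (sqr_ge0 eta); nra.
exists (Num.truncn (c * eta)^-1).+1.
have := bern (Num.truncn (c * eta)^-1).+1.
have := truncnS_gt (c * eta)^-1.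
rewrite -[X in X < _]mul1r ltr_pdivrMr ?mulr_gt0//.
move: (_ ^+ _) _%:R => M K h1 h2.
have := ler_wpM2l (ltW c0) h2; lra.
Qed.

Theorem theorem6p1 (R : realType) (d : nat) (eta : R) (eta_gt0 : 0 < eta)
    (v v' : 'rV[R]_d)
    (v_sphere : unit_sphere v) (v'_sphere : unit_sphere v')
    (neq_vv' : v <> v') (dot_vv'_gt0 : 0 < dotv v v')
    (u1 : 'rV[R]_d) (u1_sphere : unit_sphere u1)
    (u1_active : dotv u1 v <> 0 \/ dotv u1 v' <> 0)
    (dT : measure_display) (T : measurableType dT) (P : probability T R)
    (V : nat -> {RV P >-> borel_rV R d})
    (V_indep : mutually_independent V)
    (V_eq_v : forall t : nat, P (V t @^-1` [set v]) = (2^-1)%:E)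
    (V_eq_v' : forall t : nat, P (V t @^-1` [set v']) = (2^-1)%:E) :
  {ae P, forall w : T,
    let u (t : nat) := opinion eta u1 (fun s => V s w) t in
    (edist_set (u t) (cone2 v v') @[t --> \oo] --> (0 : R)) \/
    (edist_set (u t) (cone2 (- v) (- v')) @[t --> \oo] --> (0 : R))}.
Proof.
pose y (a : bool) := if a then v else v'.
pose E t (a : bool) : set T := V t @^-1` [set y a].
have my a : measurable ([set y a] : set (borel_rV R d)).
  exact: measurable_set1_borel_rV.
have mE t a : measurable (E t a) 
  by apply: measurable_funPTI.
have PE t a : P (E t a) = (2^-1)%:E by case: a; [exact: V_eq_v|exact: V_eq_v'].
have Pcyl s : (P (cylinder E s) <= ((2^-1) ^+ size s)%:E)%E.
  by rewrite (half_cylinder P V (fun a => [set y a]))//.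
have [k ck] := geometric_unbounded eta (dotv v v') eta_gt0 dot_vv'_gt0.
have VE : {ae P, forall w, forall t, V t w = v \/ V t w = v'}.
  apply: ae_foralln => t.
  (* As [v <> v'] the two events are disjoint, and two halves leave no mass elsewhere. *)
  have PU : P (E t true `|` E t false) = 1%E.
    rewrite measureU//; last first.
      by apply/seteqP; split => // w [] /=; rewrite /E /preimage /= => ->.
    transitivity (P (E t true) + P (E t false))%E => //.
    by rewrite !PE -EFinD; congr (_%:E); lra.
  exists (~` (E t true `|` E t false)); split.
  - by apply: measurableC; apply: measurableU.
  - by rewrite -[LHS]/(P _) probability_setC ?PU ?subee//; exact: measurableU.
  - by apply: subsetC => w [] /=; [left|right].
(* A constant [g] yields runs of either letter of every length, so both interventions recur
   forever. *)
have runs c := ae_foralln (fun K => constant_block_ae P E K (fun=> c) mE Pcyl).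
have dom := constant_block_ae P E k (dominant eta v v' u1) mE Pcyl.
apply: filterS (filterI (filterI VE dom) (filterI (runs true) (runs false))).
move=> w [[VEw domw] [runTw runFw]] /=.
(* By [VEw] every value other than [v] is [v'], so these bits encode the whole path. *)
pose b t := `[< V t w = v >].
have Vb t : V t w = y (b t).
  by rewrite /b; case: asboolP => // nv; case: (VEw t).
have [n domb] := domw b Vb.
have -> : (fun s => V s w) = (fun s => if b s then v else v').
  by apply/funext => s; rewrite Vb.
apply: (opinion_dichotomy _ _ _ _ _ k (n * k)) => //.
- apply: infinitely_often_of_runs => K; exact: runTw.
- apply: (infinitely_often_of_runs (negb \o b)) => K.
  have [m runm] := runFw K b Vb.
  by exists m => j jK; rewrite /= runm.
Qed.
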